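(* Let $m,n,r$ be positive integers and let $(A,B)$ be a size-$r$ nonnegative factorization, where $A\in\mathbb{R}^{m\times r}_{\ge 0}$, $B\in\mathbb{R}^{r\times n}_{\ge 0}$ and $\operatorname{rank}(AB)=r$. Then $(A,B)$ is infinitesimally rigid if and only if the cone $W_{(A,B)}^\vee\subseteq\mathbb{R}^{r\times r}$ is isomorphic to $\mathbb{R}^{r^2-r}$, meaning that $W_{(A,B)}^\vee$ is a real vector space of dimension $r^2-r$.
   Context: Inequalities between matrices are entrywise. An infinitesimal motion of $(A,B)$ is a pair $(\dot A,\dot B)\in\mathbb{R}^{m\times r}\times\mathbb{R}^{r\times n}$ with $A\dot B+\dot A B=0$ such that for some $\epsilon>0$ one has $A+t\dot A\ge 0$ and $B+t\dot B\ge 0$ for all $t\in[0,\epsilon)$. The motion is trivial if $\dot A=AD$ and $\dot B=-DB$ for some diagonal $D\in\mathbb{R}^{r\times r}$. The factorization $(A,B)$ is infinitesimally rigid if all of its infinitesimal motions are trivial. Define $W_{(A,B)}=\{D\in\mathbb{R}^{r\times r} : \exists\,\epsilon>0 \text{ such that } A+tAD\ge 0 \text{ and } B-tDB\ge 0 \text{ for all } t\in[0,\epsilon)\}$, a polyhedral cone. Its dual cone, with respect to the entrywise inner product on $\mathbb{R}^{r\times r}$, is $W_{(A,B)}^\vee$. Explicitly, let $a_1^T,\dots,a_m^T$ be the rows of $A$, $b_1,\dots,b_n$ the columns of $B$, $S_i\subseteq\{1,\dots,r\}$ the set of positions of zero entries of $a_i$, $T_i\subseteq\{1,\dots,r\}$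 the set of positions of zero entries of $b_i$, $\mathcal{A}_i=\{a_ie_j^T : j\in S_i\}$ and $\mathcal{B}_i=\{-e_jb_i^T : j\in T_i\}$; then $W_{(A,B)}^\vee=\operatorname{cone}(\mathcal{A}_1\cup\dots\cup\mathcal{A}_m\cup\mathcal{B}_1\cup\dots\cup\mathcal{B}_n)$. *)

(* Defs.v *)
From HB Require Import structures.
From mathcomp Require Import all_boot all_order all_algebra.
From mathcomp Require Import classical_sets reals.

Set Implicit Arguments.
Unset Strict Implicit.
Unset Printing Implicit Defensive.

Import Order.TTheory GRing.Theory Num.Theory.

Local Open Scope ring_scope.
Local Open Scope classical_set_scope.

Definition mx_nonneg (R : realType) (m n : nat) (M : 'M[R]_(m, n)) : Prop :=
  forall i j, 0 <= M i j.

Definition size_nonneg_factorization (R : realType) (m n r : nat)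
    (A : 'M[R]_(m, r)) (B : 'M[R]_(r, n)) : Prop :=
  [/\ mx_nonneg A, mx_nonneg B & \rank (A *m B) = r].

Definition infinitesimal_motion (R : realType) (m n r : nat)
    (A : 'M[R]_(m, r)) (B : 'M[R]_(r, n))
    (A' : 'M[R]_(m, r)) (B' : 'M[R]_(r, n)) : Prop :=
  A *m B' + A' *m B = 0 /\
  exists2 eps : R, 0 < eps &
    forall t : R, 0 <= t < eps ->
      mx_nonneg (A + t *: A') /\ mx_nonneg (B + t *: B').

Definition trivial_motion (R : realType) (m n r : nat)
    (A : 'M[R]_(m, r)) (B : 'M[R]_(r, n))
    (A' : 'M[R]_(m, r)) (B' : 'M[R]_(r, n)) : Prop :=
  exists D : 'M[R]_r, [/\ is_diag_mx D, A' = A *m D & B' = - (D *m B)].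

Definition infinitesimally_rigid (R : realType) (m n r : nat)
    (A : 'M[R]_(m, r)) (B : 'M[R]_(r, n)) : Prop :=
  forall (A' : 'M[R]_(m, r)) (B' : 'M[R]_(r, n)),
    infinitesimal_motion A B A' B' -> trivial_motion A B A' B'.

Definition motion_cone (R : realType) (m n r : nat)
    (A : 'M[R]_(m, r)) (B : 'M[R]_(r, n)) : set 'M[R]_r :=
  [set D | exists2 eps : R, 0 < eps &
    forall t : R, 0 <= t < eps ->
      mx_nonneg (A + t *: (A *m D)) /\ mx_nonneg (B - t *: (D *m B))].

Definition mx_inner (R : realType) (m n : nat) (X Y : 'M[R]_(m, n)) : R :=
  \sum_(i < m) \sum_(j < n) X i j * Y i j.

(* Sign convention: X lies in the dual cone when its pairings are nonnegative.
   With it, the dual of [motion_cone A B] contains a_i e_j^T whenever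
   A i j = 0, and - e_j b_i^T whenever B j i = 0. *)
Definition dual_cone (R : realType) (m n : nat) (C : set 'M[R]_(m, n)) :
    set 'M[R]_(m, n) :=
  [set X | forall Y, C Y -> 0 <= mx_inner X Y].

Definition is_vspace_of_dim (R : realType) (m n : nat)
    (C : set 'M[R]_(m, n)) (d : nat) : Prop :=
  exists2 V : {vspace 'M[R]_(m, n)}, C = [set X | X \in V] & \dim V = d.

(* Main.v *)
Require Import Defs.
From HB Require Import structures.
From mathcomp Require Import all_boot all_order all_algebra.
From mathcomp Require Import classical_sets reals.

Import Order.TTheory GRing.Theory Num.Theory.

Local Open Scope ring_scope.

(** Since [A *m B] has rank [r], [A] is left invertible and [B] is right
    invertible, so every solution of [A *m B' + A' *m B = 0] has the form
    [(A *m D, - (D *m B))] for a unique [D], and it is an infinitesimal motion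
    exactly when [D] lies in the cone [W = motion_cone A B]. The trivial motions
    are those with [D] diagonal, so rigidity says that [W] contains only diagonal
    matrices ([rigid_motion_coneP]).

    All diagonal matrices lie in [W], because they merely rescale the columns of
    [A] and the rows of [B] ([diag_motion_cone]). Hence the dual of [W] is always
    contained in the space [Z] of matrices with zero diagonal, of dimension
    [r ^ 2 - r]. If the factorization is rigid then [W] is the space of diagonal
    matrices and its dual is its orthogonal complement [Z]. Conversely, a dual
    cone that is a space of dimension [r ^ 2 - r] must fill [Z]; it then contains
    every off-diagonal matrix unit together with its opposite, and pairing these
    with an element of [W] shows that its off-diagonal entries vanish. *)

(** * The entrywise inner product and dual cones *)

Lemma mx_innerNl {R : realType} {m n : nat} (X Y : 'M[R]_(m, n)) :
  mx_inner (- X) Y = - mx_inner X Y.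
Proof.
rewrite /mx_inner -sumrN; apply: eq_bigr => i _.
by rewrite -sumrN; apply: eq_bigr => j _; rewrite !mxE mulNr.
Qed.

Lemma mx_innerC {R : realType} {m n : nat} (X Y : 'M[R]_(m, n)) :
  mx_inner X Y = mx_inner Y X.
Proof. by do 2![apply: eq_bigr => ? _]; rewrite mulrC. Qed.

Lemma mx_inner_delta {R : realType} {m n : nat} (Y : 'M[R]_(m, n)) i j :
  mx_inner (delta_mx i j) Y = Y i j.
Proof.
rewrite /mx_inner (bigD1 i) //= (bigD1 j) //= mxE !eqxx mul1r.
rewrite big1 => [|k /negPf kj]; last by rewrite mxE kj andbF mul0r.
rewrite addr0 big1 ?addr0 // => k /negPf ki.
by rewrite big1 // => l _; rewrite mxE ki mul0r.
Qed.

Lemma dual_cone_opp_eq0 {R : realType} {m n : nat} {C : set 'M[R]_(m, n)} {X Y} :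
  dual_cone C X -> C Y -> C (- Y) -> mx_inner X Y = 0.
Proof.
move=> CX CY CNY; apply/le_anti/andP; split; last exact: CX.
by rewrite -oppr_ge0 mx_innerC -mx_innerNl mx_innerC; apply: CX.
Qed.

(** * Matrices with zero diagonal *)

Definition diagonal (R : realType) (r : nat) (X : 'M[R]_r) : 'rV[R]_r :=
  \row_i X i i.

Fact diagonal_is_linear (R : realType) (r : nat) : linear (@diagonal R r).
Proof. by move=> a X Y; apply/rowP=> i; rewrite !mxE. Qed.

HB.instance Definition _ (R : realType) (r : nat) :=
  GRing.isLinear.Build R 'M[R]_r 'rV[R]_r _ (@diagonal R r)
    (@diagonal_is_linear R r).

Definition zero_diag (R : realType) (r : nat) : {vspace 'M[R]_r} :=
  lker (linfun (@diagonal R r)).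

Lemma zero_diagP {R : realType} {r : nat} {X : 'M[R]_r} :
  reflect (forall i, X i i = 0) (X \in zero_diag R r).
Proof.
rewrite memv_ker lfunE /=; apply: (iffP eqP) => [/rowP X0 i | X0].
  by have := X0 i; rewrite !mxE.
by apply/rowP=> i; rewrite !mxE.
Qed.

(** Reading off the diagonal is a map onto ['rV_r], with section [diag_mx], so
    this is the rank-nullity theorem. *)
Lemma dim_zero_diag (R : realType) (r : nat) :
  \dim (zero_diag R r) = (r ^ 2 - r)%N.
Proof.
have dimM p q : \dim {: 'M[R]_(p, q)} = (p * q)%N by rewrite dimvf dim_matrix.
have onto : limg (linfun (@diagonal R r)) = fullv.
  apply/eqP; rewrite eqEsubv subvf; apply/subvP=> v _.
  have -> : v = linfun (@diagonal R r) (diag_mx v).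
    by rewrite lfunE; apply/rowP=> i; rewrite !mxE eqxx mulr1n.
  exact: memv_img (memvf _).
have := limg_ker_dim (linfun (@diagonal R r)) fullv.
rewrite onto capfv !dimM mul1n mulnn -/(zero_diag R r) => <-.
by rewrite addnK.
Qed.

Lemma mx_inner_zero_diag {R : realType} {r : nat} {X D : 'M[R]_r} :
  X \in zero_diag R r -> is_diag_mx D -> mx_inner X D = 0.
Proof.
move=> /zero_diagP X0 /is_diag_mxP D0.
rewrite /mx_inner big1 // => i _; rewrite big1 // => j _.
have [<-|ij] := eqVneq i j; first by rewrite X0 mul0r.
by rewrite D0 ?mulr0.
Qed.

(** Each diagonal matrix unit lies in [C] together with its opposite, so a member
    of the dual pairs to zero with it. *)
Lemma dual_cone_zero_diag {R : realType} {r : nat} {C : set 'M[R]_r} {X} :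
  (forall D, is_diag_mx D -> C D) -> dual_cone C X -> X \in zero_diag R r.
Proof.
move=> diagC CX; apply/zero_diagP=> i.
have diag_delta : is_diag_mx (delta_mx i i : 'M[R]_r).
  apply/is_diag_mxP=> j k jk; rewrite mxE.
  by case: (eqVneq j i) jk => // ->; rewrite eq_sym val_eqE => /negPf ->.
rewrite -mx_inner_delta mx_innerC; apply: (dual_cone_opp_eq0 CX).
  exact: diagC.
apply/diagC/is_diag_mxP=> j k /(is_diag_mxP diag_delta) djk.
by rewrite mxE djk oppr0.
Qed.

(** For a set containing the diagonal matrices, having a dual of the largest
    possible dimension is the same as containing nothing else. *)
Lemma dual_cone_vspaceP {R : realType} {r : nat} {C : set 'M[R]_r} :
  (forall D, is_diag_mx D -> C D) ->
  (forall D, C D -> is_diag_mx D) <->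
  is_vspace_of_dim (dual_cone C) (r ^ 2 - r)%N.
Proof.
move=> diagC; split=> [Cdiag | [V dualV dimV] D CD].
  exists (zero_diag R r); last exact: dim_zero_diag.
  apply/seteqP; split=> X /=; first exact: dual_cone_zero_diag.
  by move=> X0 D /Cdiag Ddiag; rewrite (mx_inner_zero_diag X0).
have eqV : V = zero_diag R r.
  apply/eqP; rewrite eqEdim dimV dim_zero_diag leqnn andbT.
  apply/subvP=> X XV; apply: dual_cone_zero_diag diagC _.
  by rewrite dualV.
have dual0 X : X \in zero_diag R r -> dual_cone C X by rewrite dualV eqV.
apply/is_diag_mxP=> i j ij.
have delta0 : delta_mx i j \in zero_diag R r.
  apply/zero_diagP=> k; rewrite mxE.
  by case: eqVneq => // ->; rewrite -val_eqE (negPf ij).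
rewrite -mx_inner_delta; apply/le_anti/andP; split.
  by rewrite -oppr_ge0 -mx_innerNl; apply: dual0 => //; rewrite rpredN.
exact: dual0.
Qed.

(** * The cone of motions *)

Lemma diag_mulmxE {R : realType} {r n : nat} (D : 'M[R]_r) (B : 'M[R]_(r, n))
  i j : is_diag_mx D -> (D *m B) i j = D i i * B i j.
Proof. by case/diag_mxP=> d ->; rewrite mul_diag_mx !mxE eqxx. Qed.

Lemma mulmx_diagE {R : realType} {m r : nat} (A : 'M[R]_(m, r)) (D : 'M[R]_r)
  i j : is_diag_mx D -> (A *m D) i j = A i j * D j j.
Proof. by case/diag_mxP=> d ->; rewrite mul_mx_diag !mxE eqxx. Qed.

(** A diagonal [D] multiplies column [j] of [A] by [1 + t * D j j] and row [j]
    of [B] by [1 - t * D j j], and both factors are nonnegative for small [t]. *)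
Lemma diag_motion_cone {R : realType} {m n r : nat}
    {A : 'M[R]_(m, r)} {B : 'M[R]_(r, n)} {D : 'M[R]_r} :
  mx_nonneg A -> mx_nonneg B -> is_diag_mx D -> motion_cone A B D.
Proof.
move=> A0 B0 Ddiag; pose s := \sum_i `|D i i|.
have s1_gt0 : 0 < 1 + s by rewrite ltr_wpDr // sumr_ge0.
exists (1 + s)^-1; first by rewrite invr_gt0.
move=> t /andP[t0 lt_ts].
have tD i : `|t * D i i| <= 1.
  have le_Ds : `|D i i| <= 1 + s.
    by rewrite /s (bigD1 i) //= addrCA lerDl addr_ge0 // sumr_ge0.
  rewrite normrM (ger0_norm t0) (le_trans (ler_wpM2l t0 le_Ds)) //.
  by rewrite -ler_pdivlMr // div1r ltW.
split=> i j.
  rewrite 2!mxE mulmx_diagE // mulrCA -[X in X + _]mulr1 -mulrDr mulr_ge0 //.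
  by have := tD j; rewrite ler_norml -lerBlDl sub0r => /andP[].
rewrite 3!mxE diag_mulmxE // mulrA -[X in X - _]mul1r -mulrBl mulr_ge0 //.
by have := tD i; rewrite subr_ge0 ler_norml => /andP[].
Qed.

(** With [A1] a left inverse of [A] and [B1] a right inverse of [B], the matrix
    [D] of a motion [(A', B')] is recovered as [- (B' *m B1)]: multiply
    [A *m B' + A' *m B = 0] by [B1] on the right to get [A' = A *m D], then
    cancel [A] to get [B' = - (D *m B)]. Cancelling [A] also shows that [D] is
    unique, so a trivial motion can only come from a diagonal [D]. *)
Lemma rigid_motion_coneP {R : realType} {m n r : nat}
    {A : 'M[R]_(m, r)} {B : 'M[R]_(r, n)} :
  \rank (A *m B) = r ->
  infinitesimally_rigid A B <-> (forall D, motion_cone A B D -> is_diag_mx D).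
Proof.
move=> rAB.
have /row_fullP[A1 A1A] : row_full A.
  by rewrite /row_full eqn_leq rank_leq_col -{1}rAB mxrankM_maxl.
have /row_freeP[B1 BB1] : row_free B.
  by rewrite /row_free eqn_leq rank_leq_row -{1}rAB mxrankM_maxr.
have AI p : injective (mulmx A : 'M_(r, p) -> _).
  by apply: (can_inj (g := mulmx A1)) => X; rewrite mulmxA A1A mul1mx.
split=> [rigid D [eps eps0 epsP] | Wdiag A' B' [eq0 [eps eps0 epsP]]].
  have [|D' [D'diag /AI -> _] //] := rigid (A *m D) (- (D *m B)).
  split; first by rewrite mulmxN mulmxA addNr.
  by exists eps => // t /epsP; rewrite scalerN.
pose D := - (B' *m B1).
have A'E : A' = A *m D.
  move/(congr1 (mulmx^~ B1)): eq0.
  rewrite mulmxDl mul0mx -!mulmxA BB1 mulmx1 => /eqP.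
  by rewrite addrC addr_eq0 -mulmxN => /eqP.
have B'E : B' = - (D *m B).
  apply/AI/eqP; rewrite mulmxN -addr_eq0 mulmxA -A'E.
  exact/eqP.
exists D; split=> //; apply: Wdiag; exists eps => // t /epsP.
by rewrite A'E {1}B'E scalerN.
Qed.

Theorem proposition3p3 (R : realType) (m n r : nat)
  (hm : (0 < m)%N) (hn : (0 < n)%N) (hr : (0 < r)%N)
  (A : 'M[R]_(m, r)) (B : 'M[R]_(r, n))
  (hAB : size_nonneg_factorization A B) :
  infinitesimally_rigid A B <->
  is_vspace_of_dim (dual_cone (motion_cone A B)) (r ^ 2 - r)%N.
Proof.
have [A0 B0 rAB] := hAB.
apply: (iff_trans (rigid_motion_coneP rAB)).
by apply: dual_cone_vspaceP => D; apply: diag_motion_cone.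
Qed.
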